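(* Let $\Lambda=\{\Lambda_\omega\in B(\mathcal{H},\mathcal{K}_\omega):\omega\in\Omega\}$ be a continuous $g$-frame with lower and upper bounds $A_\Lambda,B_\Lambda$. Suppose $m\in L^\infty(\Omega,\mu)$ satisfies one of the following conditions: (i) for some positive constant $\delta$, $m(\omega)\ge\delta>0$ a.e.; (ii) $\|m-1\|_\infty\le\lambda<\frac{A_\Lambda}{B_\Lambda}$ for some $\lambda$. Then the operators $M_{m,\Lambda,\widetilde{\Lambda}}$ and $M_{m,\widetilde{\Lambda},\Lambda}$ are invertible and $$M_{m,\Lambda,\widetilde{\Lambda}}^{-1}=S_\Lambda M_{m,\Lambda,\Lambda}^{-1},\qquad M_{m,\widetilde{\Lambda},\Lambda}^{-1}=M_{m,\Lambda,\Lambda}^{-1}S_\Lambda.$$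
   Context: $(\Omega,\mu)$ is a measure space with positive measure $\mu$, $\mathcal{H}$ is a Hilbert space, $\{\mathcal{K}_\omega:\omega\in\Omega\}$ is a family of Hilbert spaces, and $B(\mathcal{H},\mathcal{K}_\omega)$ is the space of bounded linear operators. An element $F\in\prod_{\omega\in\Omega}\mathcal{K}_\omega$ is strongly measurable if $F$, as a mapping of $\Omega$ to $\bigoplus_{\omega\in\Omega}\mathcal{K}_\omega$, is measurable. A family $\Lambda=\{\Lambda_\omega\in B(\mathcal{H},\mathcal{K}_\omega):\omega\in\Omega\}$ is a continuous $g$-frame for $\mathcal{H}$ with respect to $\{\mathcal{K}_\omega\}$ if (a) for each $f\in\mathcal{H}$, $\{\Lambda_\omega f:\omega\in\Omega\}$ is strongly measurable, and (b) there are constants $0<A_\Lambda\le B_\Lambda<\infty$ (lower and upper continuous $g$-frame bounds) with $A_\Lambda\|f\|^2\le\int_\Omega\|\Lambda_\omega f\|^2\,d\mu(\omega)\le B_\Lambda\|f\|^2$ for all $f\in\mathcal{H}$. It is a continuous $g$-Bessel family if (a) holds and the right-hand inequality in (b) holds for all $f\in\mathcal{H}$. The continuous $g$-frame operator of a continuous $g$-frame $\Lambda$ is the positive invertible operator $S_\Lambda$ on $\mathcal{H}$ with $\langle S_\Lambda f,g\rangle=\int_\Omega\langle\Lambda_\omega f,\Lambda_\omega g\rangle\,d\mu(\omega)$ for $f,g\in\mathcal{H}$. The canonical dual of $\Lambda$ is the continuous $g$-frame $\widetilde{\Lambda}=\Lambda S_\Lambda^{-1}=\{\Lambda_\omega S_\Lambda^{-1}\in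 B(\mathcal{H},\mathcal{K}_\omega):\omega\in\Omega\}$. For continuous $g$-Bessel families $\Lambda,\Theta$ and $m\in L^\infty(\Omega,\mu)$, the continuous $g$-Bessel multiplier $M_{m,\Lambda,\Theta}:\mathcal{H}\to\mathcal{H}$ is the bounded operator defined by $\langle M_{m,\Lambda,\Theta}f,g\rangle=\int_\Omega m(\omega)\langle\Theta_\omega f,\Lambda_\omega g\rangle\,d\mu(\omega)$ for $f,g\in\mathcal{H}$. *)

(* Defs.v *)
From HB Require Import structures.
From mathcomp Require Import all_boot all_order all_algebra.
From mathcomp Require Import all_classical all_reals all_analysis.
From mathcomp Require Import complex.

Set Implicit Arguments.
Unset Strict Implicit.
Unset Printing Implicit Defensive.

Import Order.TTheory GRing.Theory Num.Theory.
Import numFieldNormedType.Exports.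

Local Open Scope classical_set_scope.
Local Open Scope complex_scope.
Local Open Scope ring_scope.

(* Hilbert spaces are complex; [inner] is linear in its first argument and
   conjugate-linear in its second one. *)
HB.mixin Record CompleteNormedModule_isHilbert (R : realType) H
    of CompleteNormedModule R[i] H := {
  inner : {dot H for Num.conj} ;
  sqr_normr_inner : forall x : H, `|x| ^+ 2 = inner x x
}.

#[short(type="hilbertType")]
HB.structure Definition Hilbert (R : realType) :=
  {H of CompleteNormedModule R[i] H & CompleteNormedModule_isHilbert R H}.

(* In a normed space over R[i], `|x| lives in R[i]; [rnorm x] is the same
   number seen in R. For z : R[i] this is the modulus of z. *)
Definition rnorm {R : realType} {V : normedZmodType R[i]} (x : V) : R :=
  complex.Re `|x|.

Section bounded_operators.
Context {R : realType}.
Implicit Types H K L : hilbertType R.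

Record bop H K := Bop {
  bop_fun :> H -> K ;
  bop_linear : linear bop_fun ;
  bop_bounded : exists M : R, forall x, rnorm (bop_fun x) <= M * rnorm x
}.

HB.instance Definition _ H K := gen_eqMixin (bop H K).
HB.instance Definition _ H K := gen_choiceMixin (bop H K).
HB.instance Definition _ H K (T : bop H K) :=
  GRing.isLinear.Build R[i] H K *:%R (bop_fun T) (bop_linear T).

Lemma rnorm_ge0 H (x : H) : 0 <= rnorm x.
Proof. by have := normr_ge0 x; rewrite lecE => /andP[_]. Qed.

Lemma bop0_linear H K : linear (fun _ : H => 0 : K).
Proof. by move=> a x y; rewrite scaler0 addr0. Qed.

Lemma bop0_bounded H K :
  exists M : R, forall x : H, rnorm (0 : K) <= M * rnorm x.
Proof. by exists 0 => x; rewrite /rnorm normr0 mul0r. Qed.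

Definition bop0 H K : bop H K := Bop (@bop0_linear H K) (@bop0_bounded H K).

Lemma bop_comp_linear H K L (T : bop K L) (U : bop H K) : linear (T \o U).
Proof. by move=> a x y; rewrite /= !bop_linear. Qed.

Lemma bop_comp_bounded H K L (T : bop K L) (U : bop H K) :
  exists M : R, forall x, rnorm ((T \o U) x) <= M * rnorm x.
Proof.
have [M TM] := bop_bounded T; have [N UN] := bop_bounded U.
exists (Num.max M 0 * N) => x; rewrite /= -mulrA (le_trans (TM _))//.
rewrite (@le_trans _ _ (Num.max M 0 * rnorm (U x)))//.
  by rewrite ler_wpM2r ?rnorm_ge0// le_max lexx.
by rewrite ler_wpM2l// le_max lexx orbT.
Qed.

Definition bop_comp H K L (T : bop K L) (U : bop H K) : bop H L :=
  Bop (bop_comp_linear T U) (bop_comp_bounded T U).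

Definition is_bop_inverse H (T U : bop H H) : Prop :=
  (forall x, U (T x) = x) /\ (forall x, T (U x) = x).

Definition bop_invertible H (T : bop H H) : Prop :=
  exists U, is_bop_inverse T U.

(* Junk value 0 when T is not invertible. *)
Definition bop_inv H (T : bop H H) : bop H H :=
  xget (bop0 H H) [set U | is_bop_inverse T U].

End bounded_operators.

(* The Hilbert direct sum of the K i: square-summable families, with the metric
   topology of the l2 norm. Only the topology is needed. *)
Section direct_sum.
Context {R : realType} {I : pointedType} (K : I -> hilbertType R).

Definition l2_sqnorm (g : forall i, K i) : \bar R :=
  \esum_(i in [set: I]) (rnorm (g i) ^+ 2)%:E.

Record hsum := HSum {
  hsum_val :> forall i, K i ;
  hsum_l2 : (l2_sqnorm hsum_val < +oo)%E
}.

Definition hsum_open : set (set hsum) :=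
  [set U | forall g : hsum, U g -> exists2 e : R, 0 < e &
    forall h : hsum, (l2_sqnorm (fun i => (g i - h i)%R) < (e ^+ 2)%:E)%E -> U h].

(* The family with x in position i and 0 elsewhere. *)
Definition single (i : I) (x : K i) : forall j, K j :=
  dfwith (fun j => 0 : K j) i x.

Lemma single_l2 i (x : K i) : (l2_sqnorm (single x) < +oo)%E.
Proof.
rewrite /l2_sqnorm.
suff -> : (fun j => (rnorm (single x j) ^+ 2)%:E) =
    fun j => if j \in [set i] then (rnorm (single x j) ^+ 2)%:E else 0%E.
  by rewrite -esum_mkcond esum_set1 ?ltry// lee_fin sqr_ge0.
apply/funext => j; case: ifPn => //; rewrite notin_setE /= => ji.
rewrite /single dfwithout; last by apply/eqP => ij; exact: ji.
by rewrite /rnorm normr0 expr0n.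
Qed.

Definition hsum_in (i : I) (x : K i) : hsum := HSum (single_l2 x).

HB.instance Definition _ := gen_eqMixin hsum.
HB.instance Definition _ := gen_choiceMixin hsum.
HB.instance Definition _ := isPointed.Build hsum (hsum_in (0 : K point)).

End direct_sum.
Arguments hsum_open {R I} K.

Section continuous_g_frames.
Context {R : realType} {d : measure_display} {Omega : measurableType d}.
Variable mu : {measure set Omega -> \bar R}.

(* Measurability of F as a map from Omega to the direct sum of the K w, each
   F w being viewed in that sum through K w; the direct sum carries its Borel
   sigma-algebra. *)
Definition strongly_measurable (K : Omega -> hilbertType R)
    (F : forall w, K w) : Prop :=
  measurable_fun [set: Omega]
    ((fun w => hsum_in (F w)) : Omega -> g_sigma_algebraType (hsum_open K)).

Definition cintegral (h : Omega -> R[i]) : R[i] :=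
  Rintegral mu [set: Omega] (fun w => complex.Re (h w)) +i*
  Rintegral mu [set: Omega] (fun w => complex.Im (h w)).

Definition Linfty_norm (m : Omega -> R[i]) : \bar R :=
  Lnorm mu +oo%E (fun w => (rnorm (m w))%:E).

Definition is_Linfty (m : Omega -> R[i]) : Prop :=
  [/\ measurable_fun [set: Omega] (fun w => complex.Re (m w)),
      measurable_fun [set: Omega] (fun w => complex.Im (m w)) &
      (Linfty_norm m < +oo)%E].

Context {H : hilbertType R} {K : Omega -> hilbertType R}.
Implicit Types Lambda Theta : forall w, bop H (K w).

Definition cg_frame Lambda (A B : R) : Prop :=
  [/\ forall f, strongly_measurable (fun w => Lambda w f),
      0 < A, A <= B &
      forall f : H,
        ((A * rnorm f ^+ 2)%:E <= \int[mu]_w (rnorm (Lambda w f) ^+ 2)%:E)%E /\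
        (\int[mu]_w (rnorm (Lambda w f) ^+ 2)%:E <= (B * rnorm f ^+ 2)%:E)%E].

(* The operators below are the unique ones with the given sesquilinear form
   (junk value 0 if there is none). *)
Definition cg_frame_operator Lambda : bop H H :=
  xget (bop0 H H) [set S : bop H H | forall f g : H,
    inner (S f) g = cintegral (fun w => inner (Lambda w f) (Lambda w g))].

Definition canonical_dual Lambda : forall w, bop H (K w) :=
  fun w => bop_comp (Lambda w) (bop_inv (cg_frame_operator Lambda)).

Definition cg_multiplier (m : Omega -> R[i]) Lambda Theta : bop H H :=
  xget (bop0 H H) [set M : bop H H | forall f g : H,
    inner (M f) g =
    cintegral (fun w => m w * inner (Theta w f) (Lambda w g))].

End continuous_g_frames.

(* Main.v *)
Require Import Defs.
From mathcomp Require Import all_boot all_order all_algebra.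
From mathcomp Require Import all_classical all_reals all_analysis.
From mathcomp Require Import measurable_realfun ess_sup_inf complex ring lra.

Set Implicit Arguments.
Unset Strict Implicit.
Unset Printing Implicit Defensive.

Import Order.TTheory GRing.Theory Num.Theory.
Import numFieldNormedType.Exports.

Local Open Scope classical_set_scope.
Local Open Scope complex_scope.
Local Open Scope ring_scope.

(** The form (f, g) |-> int m <Lambda f, Lambda g> is sesquilinear, bounded
    (since m is essentially bounded and Lambda is Bessel) and coercive: both
    hypotheses on m bound Re m from below by some c > 0 almost everywhere
    (c = delta in the first case; c = 1 - lambda in the second, because
    lambda < A / B <= 1), so that
    Re int m |Lambda f|^2 >= c int |Lambda f|^2 >= c A |f|^2.
    Hence the form is represented by an operator M ([form_representation]) and
    M is invertible ([coercive_invertible]): this is the Lax-Milgram theorem.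
    The symbol m = 1 gives the frame operator S, invertible and self-adjoint.

    The canonical dual is Lambda S^-1. Moving S^-1 out of either argument of
    the form, on the right by self-adjointness, gives
    M_{m, Lambda, dual} = M S^-1 and M_{m, dual, Lambda} = S^-1 M, because an
    operator is determined by its form. Inverting these two products gives the
    two formulas.

    Both halves of Lax-Milgram come from one variational principle,
    [rdot_representation]: for T bounded below and phi a bounded real-linear
    functional, the minimiser x of |T x|^2 - 2 phi x satisfies
    Re <T x, T z> = phi z for all z. With T the identity this is Riesz
    representation; with phi z = Re <y, T z> it says that T x - y is
    orthogonal to the range of T, which for coercive T forces T x = y. *)

(** * The modulus and the inner product as real quantities *)

Lemma normrE_rnorm (R : realType) (V : normedZmodType R[i]) (x : V) :
  `|x| = (rnorm x)%:C.
Proof. by rewrite /rnorm RRe_real// ger0_real. Qed.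

(** Unlike [rnorm_ge0], this covers moduli of scalars. *)
Lemma rnorm_nneg (R : realType) (V : normedZmodType R[i]) (x : V) :
  0 <= rnorm x.
Proof. by rewrite -lecR -normrE_rnorm normr_ge0. Qed.

Section normed.
Context {R : realType} {V : normedModType R[i]}.
Implicit Types x y : V.

Lemma rnorm0 : rnorm (0 : V) = 0.
Proof. by rewrite /rnorm normr0. Qed.

Lemma rnorm_eq0 x : (rnorm x == 0) = (x == 0).
Proof. by rewrite -[RHS]normr_eq0 normrE_rnorm -[LHS](inj_eq (@complexI R)). Qed.

Lemma rnormZ (a : R[i]) x : rnorm (a *: x) = rnorm a * rnorm x.
Proof. by apply: (@complexI R); rewrite rmorphM/= -!normrE_rnorm normrZ. Qed.

Lemma rnorm_real (a : R) : rnorm (a%:C) = `|a|.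
Proof. by rewrite /rnorm normc_def/= expr0n addr0 sqrtr_sqr. Qed.

Lemma rnormB_sym x y : rnorm (x - y) = rnorm (y - x).
Proof. by rewrite /rnorm distrC. Qed.

Lemma rnormN x : rnorm (- x) = rnorm x.
Proof. by rewrite /rnorm normrN. Qed.

Lemma rnormD x y : rnorm (x + y) <= rnorm x + rnorm y.
Proof. by rewrite -lecR rmorphD/= -!normrE_rnorm ler_normD. Qed.

End normed.

Section complex_modulus.
Context {R : realType}.
Implicit Types z : R[i].

Lemma rnorm1 : rnorm (1 : R[i]) = 1.
Proof. by rewrite /rnorm normr1. Qed.

Lemma normr_Re_le z : `|complex.Re z| <= rnorm z.
Proof.
rewrite /rnorm normc_def/= -sqrtr_sqr ler_wsqrtr// lerDl sqr_ge0//.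
Qed.

Lemma normr_Im_le z : `|complex.Im z| <= rnorm z.
Proof.
rewrite /rnorm normc_def/= -sqrtr_sqr ler_wsqrtr// lerDr sqr_ge0//.
Qed.

Lemma ReM z1 z2 : complex.Re (z1 * z2) =
  complex.Re z1 * complex.Re z2 - complex.Im z1 * complex.Im z2.
Proof. by case: z1 z2 => a b [c e]. Qed.

Lemma ImM z1 z2 : complex.Im (z1 * z2) =
  complex.Re z1 * complex.Im z2 + complex.Im z1 * complex.Re z2.
Proof. by case: z1 z2 => a b [c e]. Qed.

Lemma ReD z1 z2 : complex.Re (z1 + z2) = complex.Re z1 + complex.Re z2.
Proof. by case: z1 z2 => a b [c e]. Qed.

Lemma ImD z1 z2 : complex.Im (z1 + z2) = complex.Im z1 + complex.Im z2.
Proof. by case: z1 z2 => a b [c e]. Qed.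

Lemma complex_eq z1 z2 : complex.Re z1 = complex.Re z2 ->
  complex.Im z1 = complex.Im z2 -> z1 = z2.
Proof. by case: z1 z2 => a b [c e] /= -> ->. Qed.

End complex_modulus.

Section inner_product.
Context {R : realType} {H : hilbertType R}.
Implicit Types x y z : H.

Lemma innerC x y : inner x y = (inner y x)^*%C.
Proof. by rewrite hermC expr0 mul1r. Qed.

Lemma innerDl x y z : inner (x + y) z = inner x z + inner y z.
Proof. exact: linearDl. Qed.

Lemma innerZl a x z : inner (a *: x) z = a * inner x z.
Proof. exact: linearZl_LR. Qed.

Lemma innerDr x y z : inner z (x + y) = inner z x + inner z y.
Proof. exact: linearDr. Qed.

Lemma innerZr a x z : inner z (a *: x) = a^*%C * inner z x.
Proof. exact: linearZr_LR. Qed.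

(** The real inner product underlying [inner]; it recovers the complex one
    through [Im_inner], so all estimates can be made over the reals. *)
Definition rdot x y : R := complex.Re (inner x y).

Lemma rdotC x y : rdot x y = rdot y x.
Proof. by rewrite /rdot innerC; case: (inner y x). Qed.

Lemma rdotDl x y z : rdot (x + y) z = rdot x z + rdot y z.
Proof. by rewrite /rdot innerDl ReD. Qed.

Lemma rdotZl a x z : rdot (a%:C *: x) z = a * rdot x z.
Proof. by rewrite /rdot innerZl ReM/= mul0r subr0. Qed.

Lemma rdotDr x y z : rdot z (x + y) = rdot z x + rdot z y.
Proof. by rewrite rdotC rdotDl !(rdotC z). Qed.

Lemma rdotZr a x z : rdot z (a%:C *: x) = a * rdot z x.
Proof. by rewrite rdotC rdotZl (rdotC z). Qed.

Lemma rdotNr x z : rdot z (- x) = - rdot z x.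
Proof. by rewrite -scaleN1r -[-1](_ : (-1)%:C = _) ?rdotZr ?mulN1r// rmorphN1. Qed.

Lemma rdotNl x z : rdot (- x) z = - rdot x z.
Proof. by rewrite rdotC rdotNr rdotC. Qed.

Lemma innerxx x : inner x x = (rnorm x ^+ 2)%:C.
Proof. by rewrite -sqr_normr_inner normrE_rnorm rmorphXn. Qed.

Lemma rdotxx x : rdot x x = rnorm x ^+ 2.
Proof. by rewrite /rdot innerxx. Qed.

Lemma Im_inner x y : complex.Im (inner x y) = rdot x ('i%C *: y).
Proof. by rewrite /rdot innerZr ReM/=; ring. Qed.

Lemma rdot_eq0 x : (forall z, rdot x z = 0) -> x = 0.
Proof.
by move=> /(_ x)/eqP; rewrite rdotxx sqrf_eq0 rnorm_eq0 => /eqP.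
Qed.

Lemma inner_inj x y : (forall z, inner x z = inner y z) -> x = y.
Proof.
move=> xy; apply/eqP; rewrite -subr_eq0; apply/eqP/rdot_eq0 => z.
by rewrite rdotDl rdotNl /rdot xy subrr.
Qed.

Lemma rnormD_sq x y : rnorm (x + y) ^+ 2 =
  rnorm x ^+ 2 + 2 * rdot x y + rnorm y ^+ 2.
Proof. rewrite -!rdotxx !(rdotDl, rdotDr) (rdotC y x); ring. Qed.

(** Additive bounds are what integration provides, since |Lambda f| |Lambda g|
    is at most the sum of the squares; scaling x by |y| and y by |x| balances
    the two squares and turns such a bound into a multiplicative one. *)
Lemma homogeneous_bound (b : H -> H -> R) (C : R) :
    (forall s t x y, b (s%:C *: x) (t%:C *: y) = s * t * b x y) ->
    (forall x y, b x y <= C * (rnorm x ^+ 2 + rnorm y ^+ 2)) ->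
  forall x y, `|b x y| <= 2 * C * rnorm x * rnorm y.
Proof.
move=> bZ bC x y.
have bZ1 s x' y' : b (s%:C *: x') y' = s * b x' y'.
  by rewrite -{1}[y']scale1r -[1 in LHS](rmorph1 (real_complex R)) bZ mulr1.
have bZ2 s x' y' : b x' (s%:C *: y') = s * b x' y'.
  by rewrite -{1}[x']scale1r -[1 in LHS](rmorph1 (real_complex R)) bZ mul1r.
have [->|x0] := eqVneq x 0.
  by rewrite -[0](scale0r 0) -(rmorph0 (real_complex R)) bZ1 rmorph0 scale0r
    rnorm0 mul0r normr0 mulr0 mul0r.
have [->|y0] := eqVneq y 0.
  by rewrite -[0](scale0r 0) -(rmorph0 (real_complex R)) bZ2 rmorph0 scale0r
    rnorm0 mul0r normr0 mulr0.
have nx : 0 < rnorm x by rewrite lt_neqAle rnorm_ge0 eq_sym rnorm_eq0 x0.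
have ny : 0 < rnorm y by rewrite lt_neqAle rnorm_ge0 eq_sym rnorm_eq0 y0.
have nxy : 0 < rnorm x * rnorm y by exact: mulr_gt0.
rewrite ler_norml; apply/andP; split.
- have := bC ((- rnorm y)%:C *: x) ((rnorm x)%:C *: y).
  rewrite bZ !rnormZ !rnorm_real normrN !gtr0_norm// => h.
  rewrite -(ler_pM2l nxy); nra.
- have := bC ((rnorm y)%:C *: x) ((rnorm x)%:C *: y).
  rewrite bZ !rnormZ !rnorm_real !gtr0_norm// => h.
  rewrite -(ler_pM2l nxy); nra.
Qed.

Lemma rdot_le_sq x y : rdot x y <= 2^-1 * (rnorm x ^+ 2 + rnorm y ^+ 2).
Proof.
have := sqr_ge0 (rnorm (x + - y)); rewrite rnormD_sq rdotNr rnormN; lra.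
Qed.

Lemma rdot_CS x y : `|rdot x y| <= rnorm x * rnorm y.
Proof.
have := @homogeneous_bound rdot 2^-1 _ rdot_le_sq x y.
rewrite mulfV// mul1r; apply => s t x' y'.
by rewrite rdotZl rdotZr mulrA.
Qed.

(** Completeness, for the norm with values in R instead of R[i]. *)
Lemma cauchy_seq_limit (u : nat -> H) :
    (forall e : R, 0 < e -> exists N, forall n k, (N <= n)%N -> (N <= k)%N ->
      rnorm (u n - u k) < e) ->
  exists x, forall e : R, 0 < e ->
    exists N, forall n, (N <= n)%N -> rnorm (u n - x) < e.
Proof.
move=> u_cauchy.
have ReE (e : R[i]) : 0 < e -> 0 < complex.Re e /\ e = (complex.Re e)%:C.
  by case: e => a b; rewrite ltcE/= => /andP[/eqP-> ->].
have : cvg (u @ \oo).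
  apply/cauchy_cvgP/cauchy_ballP => e /ReE[e0 eE]; near_simpl.
  have [N uN] := u_cauchy _ e0.
  exists ([set n | (N <= n)%N], [set n | (N <= n)%N]) => /=.
    by split; exists N.
  by case=> n k [/= Nn Nk]; rewrite -ball_normE/= eE normrE_rnorm ltcR uN.
move=> /cvg_ex[x ux]; exists x => e e0.
have /cvgrPdist_lt/(_ e%:C) := ux; rewrite ltcR => /(_ e0)[N _ uN].
by exists N => n Nn; rewrite rnormB_sym -ltcR -normrE_rnorm uN.
Qed.

End inner_product.

(** * Bounded operators from sesquilinear forms *)

Section operators.
Context {R : realType} {H : hilbertType R}.
Implicit Types (x y z : H) (T U : bop H H).

Lemma eq_bop (L : hilbertType R) (T U : bop H L) : (forall x, T x = U x) -> T = U.
Proof.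
case: T U => [t tl tb] [u ul ub] /= /funext tu; subst u.
by rewrite (Prop_irrelevance tl ul) (Prop_irrelevance tb ub).
Qed.

Lemma bopD (L : hilbertType R) (T : bop H L) x y : T (x + y) = T x + T y.
Proof. exact: linearD. Qed.

Lemma bopB (L : hilbertType R) (T : bop H L) x y : T (x - y) = T x - T y.
Proof. exact: linearB. Qed.

Lemma bopZ (L : hilbertType R) (T : bop H L) a x : T (a *: x) = a *: T x.
Proof. exact: linearZ. Qed.

Lemma bop_id_linear : linear (idfun : H -> H).
Proof. by []. Qed.

Lemma bop_id_bounded : exists M : R, forall x, rnorm (idfun x) <= M * rnorm x.
Proof. by exists 1 => x; rewrite mul1r. Qed.

Definition bop_id : bop H H := Bop bop_id_linear bop_id_bounded.

(** Existence of the minimiser of J x = |T x|^2 - 2 phi x. J is bounded below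
    since T is; by the parallelogram law a minimising sequence has Cauchy
    images under T, hence is Cauchy. As phi is only real-linear, the
    variation is taken along real multiples of z. *)
Lemma rdot_representation T (c C : R) (phi : H -> R) :
    0 < c -> (forall x, c * rnorm x <= rnorm (T x)) ->
    (forall x y, phi (x + y) = phi x + phi y) ->
    (forall (a : R) x, phi (a%:C *: x) = a * phi x) ->
    (forall x, `|phi x| <= C * rnorm x) ->
  exists x, forall z, rdot (T x) (T z) = phi z.
Proof.
move=> c0 cT phiD phiZ phiC.
pose J x := rnorm (T x) ^+ 2 - 2 * phi x.
have JD x z : J (x + z) = J x + 2 * (rdot (T x) (T z) - phi z) + rnorm (T z) ^+ 2.
  by rewrite /J bopD rnormD_sq phiD; ring.
have phiN x : phi (- x) = - phi x.
  by rewrite -scaleN1r -(rmorphN1 (real_complex R)) phiZ mulN1r.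
have cT2 x : c ^+ 2 * rnorm x ^+ 2 <= rnorm (T x) ^+ 2.
  have := cT x; have := rnorm_ge0 x => ? ?; rewrite -exprMn lerXn2r// nnegrE.
    by rewrite mulr_ge0// ltW.
  exact: rnorm_ge0.
(* completing the square in |x|; the minimum is reached at |x| = C / c^2 *)
have Jlb x : - (C ^+ 2 / c ^+ 2) <= J x.
  have := phiC x; have := cT2 x; rewrite ler_norml => h /andP[_ h2].
  have : 0 <= (c * rnorm x - C / c) ^+ 2 by exact: sqr_ge0.
  have -> : (c * rnorm x - C / c) ^+ 2 =
    c ^+ 2 * rnorm x ^+ 2 - 2 * (C * rnorm x) + C ^+ 2 / c ^+ 2.
    by field; exact: lt0r_neq0.
  rewrite /J; lra.
pose mu := inf (range J).
have hinf : has_inf (range J).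
  by split; [exists (J 0), 0 | exists (- (C ^+ 2 / c ^+ 2)) => _ [x _ <-]].
have muJ x : mu <= J x by apply: ge_inf; [exact: hinf.2|exists x].
have /choice[u uJ] (n : nat) : exists x, J x < mu + n.+1%:R^-1.
  have n0 : 0 < n.+1%:R^-1 :> R by rewrite invr_gt0.
  by have [_ [x _ <-] Jx] := inf_adherent n0 hinf; exists x.
have parallelogram x y :
    rnorm (T (x - y)) ^+ 2 = 2 * J x + 2 * J y - 4 * J ((2^-1)%:C *: (x + y)).
  rewrite /J phiZ phiD bopZ bopB bopD rnormZ rnorm_real !rnormD_sq.
  rewrite exprMn (ger0_norm (_ : 0 <= 2^-1 :> R))// rnormD_sq rdotNr rnormN.
  by field.
have u_cauchy N n k : (N <= n)%N -> (N <= k)%N ->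
    c ^+ 2 * rnorm (u n - u k) ^+ 2 <= 4 / N.+1%:R.
  move=> Nn Nk; rewrite (le_trans (cT2 _))// parallelogram.
  have inv_le j : (N <= j)%N -> j.+1%:R^-1 <= N.+1%:R^-1 :> R.
    by move=> Nj; rewrite lef_pV2 ?posrE// ler_nat.
  have := inv_le _ Nn; have := inv_le _ Nk.
  have := uJ n; have := uJ k; have := muJ ((2^-1)%:C *: (u n + u k)).
  move: (n.+1%:R^-1) (k.+1%:R^-1) (N.+1%:R^-1) => i1 i2 i3.
  move: (J (u n)) (J (u k)) (J _) => j1 j2 j3; lra.
have [x ux] : exists x, forall e : R, 0 < e ->
    exists N, forall n, (N <= n)%N -> rnorm (u n - x) < e.
  apply: cauchy_seq_limit => e e0.
  have ce : 0 < c ^+ 2 * e ^+ 2 by rewrite mulr_gt0// exprn_gt0.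
  have [N hN] : exists N : nat, 4 / N.+1%:R < c ^+ 2 * e ^+ 2.
    exists (Num.truncn (4 / (c ^+ 2 * e ^+ 2))).
    by rewrite ltr_pdivrMr// mulrC -ltr_pdivrMr// truncnS_gt.
  exists N => n k Nn Nk.
  have := le_lt_trans (u_cauchy N n k Nn Nk) hN.
  by rewrite ltr_pM2l ?exprn_gt0// ltr_pXn2r// nnegrE ?rnorm_ge0// ltW.
have [M TM] := bop_bounded T.
(* lower semicontinuity at x is enough: it follows from the expansion [JD] at
   x, in which only the linear term can be negative *)
have Jx : J x <= mu.
  pose D := rnorm (T x) * `|M| + `|C|.
  have D0 : 0 <= D by rewrite addr_ge0// mulr_ge0// rnorm_ge0.
  have JuJ n : J x <= J (u n) + 2 * D * rnorm (u n - x).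
    have {1}-> : u n = x + (u n - x) by rewrite addrC subrK.
    rewrite JD; set z := u n - x.
    have z0 := rnorm_ge0 z; have Tx0 := rnorm_ge0 (T x).
    have h1 : - (rnorm (T x) * (`|M| * rnorm z)) <= rdot (T x) (T z).
      have := rdot_CS (T x) (T z); rewrite ler_norml => /andP[+ _].
      apply: le_trans; rewrite lerN2 ler_wpM2l// (le_trans (TM z))//.
      by rewrite ler_wpM2r// ler_norm.
    have h2 : phi z <= `|C| * rnorm z.
      rewrite (le_trans (ler_norm _))// (le_trans (phiC z))//.
      by rewrite ler_wpM2r// ler_norm.
    have := sqr_ge0 (rnorm (T z)); rewrite /D; lra.
  rewrite leNgt; apply/negP => muJx.
  pose e := J x - mu; have e0 : 0 < e by rewrite subr_gt0.
  have De : 0 < e / (2 * (2 * D + 1)) by rewrite divr_gt0// mulr_gt0//; lra.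
  have [N1 hN1] := ux _ De.
  pose n := maxn N1 (Num.truncn (2 / e)).
  have hn : n.+1%:R^-1 < e / 2.
    rewrite -[e / 2]invrK ltf_pV2 ?posrE// ?invr_gt0 ?divr_gt0// invf_div.
    rewrite (lt_le_trans (truncnS_gt _))// ler_nat ltnS leq_maxr//.
  have hn1 := hN1 n (leq_maxl _ _).
  have hD : 2 * D * rnorm (u n - x) <= e / 2.
    have : (2 * D + 1) * rnorm (u n - x) <= e / 2.
      rewrite mulrC -ler_pdivlMr; last by lra.
      by rewrite (le_trans (ltW hn1))// invfM mulrA.
    by have := rnorm_ge0 (u n - x); lra.
  have := JuJ n; have := uJ n; move: hn hD; rewrite /e.
  by move: (n.+1%:R^-1) (2 * D * _) => i1 i2; lra.
exists x => z.
(* b is half the derivative of t |-> J (x + t z) at the minimum t = 0 *)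
apply/eqP; rewrite -subr_eq0; set b := _ - _.
have Jt (t : R) : 0 <= 2 * t * b + t ^+ 2 * rnorm (T z) ^+ 2.
  have := muJ (x + t%:C *: z); rewrite JD bopZ rdotZr phiZ rnormZ rnorm_real.
  rewrite exprMn real_normK ?num_real// /b; lra.
apply/negPn/negP => b0; set q := rnorm (T z) ^+ 2 in Jt.
have q0 : 0 <= q by exact: sqr_ge0.
(* -b / q would minimise the quadratic; the added 1 avoids the case q = 0 *)
have := Jt (- b / (q + 1)).
have -> : 2 * (- b / (q + 1)) * b + (- b / (q + 1)) ^+ 2 * q =
  - (b ^+ 2 * ((q + 2) / (q + 1) ^+ 2)) by field; apply: lt0r_neq0; lra.
rewrite oppr_ge0 leNgt mulr_gt0// ?exprn_even_gt0// divr_gt0//; first by lra.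
by rewrite exprn_gt0//; lra.
Qed.

(** Riesz representation of each z |-> Re (q x z) yields T x; replacing z by
    i z recovers the imaginary parts. *)
Lemma form_representation (q : H -> H -> R[i]) (C : R) :
    (forall a x y z, q (a *: x + y) z = a * q x z + q y z) ->
    (forall a x y z, q z (a *: x + y) = a^*%C * q z x + q z y) ->
    (forall x y, complex.Re (q x y) <= C * (rnorm x ^+ 2 + rnorm y ^+ 2)) ->
  exists T : bop H H, forall x y, inner (T x) y = q x y.
Proof.
move=> ql qr qC.
have q0l z : q 0 z = 0.
  by have := ql (-1) 0 0 z; rewrite scaler0 addr0 mulN1r addNr.
have q0r z : q z 0 = 0.
  have := qr (-1) 0 0 z; rewrite scaler0 addr0 rmorphN1 mulN1r addNr//.
have qZl a x z : q (a *: x) z = a * q x z by rewrite -[_ *: x]addr0 ql q0l addr0.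
have qZr a x z : q z (a *: x) = a^*%C * q z x by rewrite -[_ *: x]addr0 qr q0r addr0.
have qDr x y z : q z (x + y) = q z x + q z y.
  by rewrite -[x in LHS]scale1r qr rmorph1 mul1r.
have qb : forall x y, `|complex.Re (q x y)| <= 2 * C * rnorm x * rnorm y.
  apply: homogeneous_bound => // s t x y.
  by rewrite qZl qZr !ReM/=; ring.
have /choice[T TE] x : exists v, forall z, inner v z = q x z.
  have [//|v|v w|a v|v|v vE] := @rdot_representation bop_id 1 (2 * C * rnorm x)
    (fun z => complex.Re (q x z)).
  - by rewrite mul1r.
  - by rewrite qDr ReD.
  - by rewrite qZr ReM/=; ring.
  - exact: qb.
  exists v => z; apply: complex_eq; first exact: vE.
  by rewrite Im_inner (vE ('i%C *: z)) qZr ReM/=; ring.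
have T_linear : linear T.
  move=> a x y; apply: inner_inj => z.
  by rewrite innerDl innerZl !TE ql.
have T_bounded : exists M : R, forall x, rnorm (T x) <= M * rnorm x.
  exists `|2 * C| => x.
  have := qb x (T x); rewrite -TE -/(rdot _ _) rdotxx => /(le_trans (ler_norm _)).
  have [->|Tx0] := eqVneq (T x) 0.
    by move=> _; rewrite rnorm0 mulr_ge0// rnorm_ge0.
  rewrite expr2 ler_pM2r; last by rewrite lt_neqAle rnorm_ge0 eq_sym rnorm_eq0 Tx0.
  by move=> /le_trans; apply; rewrite ler_wpM2r ?rnorm_ge0// ler_norm.
by exists (Bop T_linear T_bounded).
Qed.

(** Coercivity bounds T below by the Cauchy-Schwarz inequality, which gives
    injectivity and the boundedness of the inverse. For surjectivity, the
    representation theorem gives x with w = T x - y orthogonal to the range of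
    T; then c |w|^2 <= Re <T w, w> = 0. *)
Lemma coercive_invertible T (c : R) : 0 < c ->
  (forall x, c * rnorm x ^+ 2 <= rdot (T x) x) -> bop_invertible T.
Proof.
move=> c0 Tc.
have cT x : c * rnorm x <= rnorm (T x).
  have [->|x0] := eqVneq x 0; first by rewrite rnorm0 mulr0 rnorm_ge0.
  have nx : 0 < rnorm x by rewrite lt_neqAle rnorm_ge0 eq_sym rnorm_eq0 x0.
  rewrite -(ler_pM2r nx) -mulrA -expr2 (le_trans (Tc x))//.
  by rewrite (le_trans (ler_norm _))// rdot_CS.
have Tinj x y : T x = T y -> x = y.
  move=> Txy; apply/eqP; rewrite -subr_eq0 -rnorm_eq0 -(mulrI_eq0 _ (lregP (lt0r_neq0 c0))).
  rewrite eq_le mulr_ge0 ?rnorm_ge0 ?(ltW c0)// andbT.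
  by rewrite (le_trans (cT _))// bopB Txy subrr rnorm0.
have [M TM] := bop_bounded T.
have /choice[U TU] y : exists x, T x = y.
  have [//|//|u v|a u|u|x xE] := @rdot_representation T c (rnorm y * `|M|)
    (fun z => rdot y (T z)).
  - by rewrite bopD rdotDr.
  - by rewrite bopZ rdotZr.
  - rewrite (le_trans (rdot_CS _ _))// -mulrA ler_wpM2l ?rnorm_ge0//.
    by rewrite (le_trans (TM _))// ler_wpM2r ?rnorm_ge0// ler_norm.
  exists x; apply/eqP; rewrite -subr_eq0 -rnorm_eq0 -sqrf_eq0.
  rewrite eq_le sqr_ge0 andbT -(pmulr_rle0 _ c0) (le_trans (Tc _))//.
  by rewrite rdotC rdotDl rdotNl xE subrr.
have U_linear : linear U.
  by move=> a x y; apply: Tinj; rewrite bop_linear !TU.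
have U_bounded : exists M : R, forall x, rnorm (U x) <= M * rnorm x.
  exists c^-1 => x; rewrite mulrC ler_pdivlMr// mulrC.
  by rewrite -[x in leRHS]TU cT.
exists (Bop U_linear U_bounded); split => x /=; last exact: TU.
by apply: Tinj; rewrite TU.
Qed.

Lemma bop_invE T U : is_bop_inverse T U -> bop_inv T = U.
Proof.
move=> TU; apply: xget_unique => // V [VT _].
by apply: eq_bop => x; rewrite -{1}[x](TU.2) VT.
Qed.

Lemma bop_invP T : bop_invertible T -> is_bop_inverse T (bop_inv T).
Proof. by move=> [U TU]; rewrite (bop_invE TU). Qed.

End operators.

(** * Strongly measurable families *)

Section measurability.
Context {R : realType} {d : measure_display} {Omega : measurableType d}.
Context (K : Omega -> hilbertType R).

Lemma coord_le_l2 (g : forall w, K w) w (e : R) : 0 < e ->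
  (l2_sqnorm g < (e ^+ 2)%:E)%E -> rnorm (g w) < e.
Proof.
move=> e0 ge; rewrite -(ltr_pXn2r (ltn0Sn 1)) ?nnegrE ?rnorm_ge0 ?ltW//.
rewrite -lte_fin; apply: le_lt_trans ge; apply: esum_ge.
by exists [set w]; [split|rewrite fsbig_set1].
Qed.

(** The families having some coordinate of norm above a form an open set of the
    direct sum, because each coordinate is 1-Lipschitz for the l2 norm. Its
    preimage under w |-> F w, seen in the coordinate w, is where |F w| > a. *)
Lemma measurable_rnorm (F : forall w, K w) : strongly_measurable F ->
  measurable_fun [set: Omega] (fun w => rnorm (F w)).
Proof.
move=> mF; apply: (measurability _ (RGenOInfty.measurableE R)) => //.
move=> _ [_ [a ->] <-]; rewrite setTI.
pose U : set (hsum K) := [set g | exists w, a < rnorm (g w)].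
have oU : hsum_open K U.
  move=> g [w aw]; exists (rnorm (g w) - a); first by rewrite subr_gt0.
  move=> h gh; exists w.
  have := @coord_le_l2 (fun i => g i - h i) w _ _ gh; rewrite subr_gt0 => /(_ aw).
  have := rnormD (g w - h w) (h w); rewrite subrK; lra.
have mU : measurable (U : set (g_sigma_algebraType (hsum_open K))).
  exact: sub_sigma_algebra.
have := mF measurableT U mU; rewrite setTI.
congr measurable; apply/seteqP; split => w /=.
(* off the coordinate w the norm is 0, which exceeds a only if a < 0, and
   then |F w| exceeds a as well *)
- rewrite in_itv/= andbT => -[v]; rewrite /= /single.
  have [<-|wv] := eqVneq w v; first by rewrite dfwithin.
  rewrite dfwithout// rnorm0 => /lt_le_trans; apply; exact: rnorm_ge0.
- by rewrite in_itv/= andbT => aw; exists w; rewrite /= /single dfwithin.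
Qed.

(** By polarisation; for images under linear maps the hypothesis on the sum is
    an instance of strong measurability at f + g. *)
Lemma measurable_rdot (F G : forall w, K w) :
  strongly_measurable F -> strongly_measurable G ->
  strongly_measurable (fun w => F w + G w) ->
  measurable_fun [set: Omega] (fun w => rdot (F w) (G w)).
Proof.
move=> mF mG mFG.
have -> : (fun w => rdot (F w) (G w)) = (fun w => 2^-1 *
    (rnorm (F w + G w) ^+ 2 - rnorm (F w) ^+ 2 - rnorm (G w) ^+ 2)).
  by apply/funext => w; rewrite rnormD_sq; field.
apply: measurable_funM; first exact: measurable_cst.
by apply: measurable_funB; [apply: measurable_funB|];
  apply: measurable_funX; exact: measurable_rnorm.
Qed.

End measurability.

(** * Integration of complex functions *)

Section integration.
Context {R : realType} {d : measure_display} {Omega : measurableType d}.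
Variable mu : {measure set Omega -> \bar R}.

Lemma ae_le_integrable (h g : Omega -> R) :
    measurable_fun [set: Omega] h -> mu.-integrable [set: Omega] (EFin \o g) ->
    {ae mu, forall w, `|h w| <= g w} ->
  mu.-integrable [set: Omega] (EFin \o h).
Proof.
move=> mh /integrableP[mg gfin] hg; apply/integrableP; split.
  exact/measurable_EFinP.
apply: le_lt_trans gfin; apply: ae_ge0_le_integral => //=.
- by apply/measurable_EFinP; exact: measurableT_comp.
- by apply/measurable_EFinP; apply: measurableT_comp => //; exact/measurable_EFinP.
- by apply: filterS hg => w hg _; rewrite lee_fin (le_trans hg)// ler_norm.
Qed.

Lemma ae_le_Rintegral (h1 h2 : Omega -> R) :
    mu.-integrable [set: Omega] (EFin \o h1) ->
    mu.-integrable [set: Omega] (EFin \o h2) ->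
    {ae mu, forall w, h1 w <= h2 w} ->
  Rintegral mu [set: Omega] h1 <= Rintegral mu [set: Omega] h2.
Proof.
move=> i1 i2 h12; rewrite -subr_ge0 -RintegralB//.
(* h2 - h1 agrees almost everywhere with its absolute value *)
have ms : measurable_fun [set: Omega] (EFin \o (h2 \- h1)).
  by apply/measurable_EFinP; apply: measurable_funB; apply/measurable_EFinP;
    [exact: measurable_int i2|exact: measurable_int i1].
rewrite /Rintegral fine_ge0//.
rewrite (@ae_eq_integral _ _ _ mu setT (fun w => `|(h2 w - h1 w)%:E|)%E)//.
- exact: integral_ge0.
- exact: measurableT_comp.
- apply: filterS h12 => w h12 _ /=.
  by rewrite ger0_norm// subr_ge0.
Qed.

Lemma integrable_realZ (k : R) (h : Omega -> R) :
  mu.-integrable [set: Omega] (EFin \o h) ->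
  mu.-integrable [set: Omega] (fun w => (k * h w)%:E).
Proof. by move=> ih; exact: (integrableZl measurableT k ih). Qed.

Lemma integrable_realD (h k : Omega -> R) :
  mu.-integrable [set: Omega] (EFin \o h) ->
  mu.-integrable [set: Omega] (EFin \o k) ->
  mu.-integrable [set: Omega] (fun w => (h w + k w)%:E).
Proof. by move=> ih ik; exact: (integrableD measurableT ih ik). Qed.

Definition cintegrable (h : Omega -> R[i]) : Prop :=
  mu.-integrable [set: Omega] (fun w => (complex.Re (h w))%:E) /\
  mu.-integrable [set: Omega] (fun w => (complex.Im (h w))%:E).

Lemma cintegral_linear a (h1 h2 : Omega -> R[i]) :
    cintegrable h1 -> cintegrable h2 ->
  cintegral mu (fun w => a * h1 w + h2 w) =
  a * cintegral mu h1 + cintegral mu h2.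
Proof.
move=> [r1 i1] [r2 i2].
apply: complex_eq; rewrite /cintegral/= !(ReD, ImD) !(ReM, ImM)/=.
- under eq_Rintegral do rewrite ReD ReM -mulNr.
  rewrite !RintegralD ?RintegralZl//; do ?[apply: integrable_realD | apply: integrable_realZ] => //.
  by rewrite mulNr.
- under eq_Rintegral do rewrite ImD ImM.
  by rewrite !RintegralD ?RintegralZl//; do ?[apply: integrable_realD | apply: integrable_realZ].
Qed.

Lemma cintegral_conj (h : Omega -> R[i]) : cintegrable h ->
  cintegral mu (fun w => (h w)^*%C) = (cintegral mu h)^*%C.
Proof.
move=> [rh ih]; apply: complex_eq; rewrite /cintegral/=.
  by apply: eq_Rintegral => w _; case: (h w).
rewrite -mulN1r -RintegralZl//; apply: eq_Rintegral => w _.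
by rewrite mulN1r; case: (h w).
Qed.

Lemma Linfty_norm_ae (m : Omega -> R[i]) (C : R) :
  (Linfty_norm mu m <= C%:E)%E -> {ae mu, forall w, rnorm (m w) <= C}.
Proof.
rewrite /Linfty_norm unlock; case: ifPn => [_ /ess_supP|].
  by apply: filterS => w /=; rewrite lee_fin ger0_norm// rnorm_nneg.
(* the norm is 0 by convention when mu = 0, and then everything is negligible *)
rewrite -leNgt measure_le0 => /eqP mu0 _.
by exists setT.
Qed.

End integration.

(** * Multipliers of a continuous g-frame *)

Section multipliers.
Context {R : realType} {d : measure_display} {Omega : measurableType d}.
Variable mu : {measure set Omega -> \bar R}.
Context {H : hilbertType R} {K : Omega -> hilbertType R}.
Variables (Lambda : forall w, bop H (K w)) (A B : R).
Hypothesis frameL : cg_frame mu Lambda A B.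
Implicit Types (m : Omega -> R[i]) (f g : H).

Lemma measurable_frame_norm f :
  measurable_fun [set: Omega] (fun w => rnorm (Lambda w f) ^+ 2).
Proof.
have [mL _ _ _] := frameL.
by apply: measurable_funX; exact: measurable_rnorm.
Qed.

Lemma measurable_rdot_frame f g :
  measurable_fun [set: Omega] (fun w => rdot (Lambda w f) (Lambda w g)).
Proof.
have [mL _ _ _] := frameL; apply: measurable_rdot => //.
rewrite [X in strongly_measurable X](_ : _ = fun w => Lambda w (f + g))//.
by apply: functional_extensionality_dep => w; rewrite bopD.
Qed.

Lemma measurable_Im_frame f g :
  measurable_fun [set: Omega] (fun w => complex.Im (inner (Lambda w f) (Lambda w g))).
Proof.
under eq_fun do rewrite Im_inner -bopZ.
exact: measurable_rdot_frame.
Qed.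

Lemma integrable_frame_norm f :
  mu.-integrable [set: Omega] (fun w => (rnorm (Lambda w f) ^+ 2)%:E).
Proof.
have [_ _ _ /(_ f)[_ fB]] := frameL; apply/integrableP; split.
  exact/measurable_EFinP/measurable_frame_norm.
under eq_integral do rewrite gee0_abs ?lee_fin ?sqr_ge0//.
exact: le_lt_trans fB (ltry _).
Qed.

Lemma frame_bounds f :
  A * rnorm f ^+ 2 <= Rintegral mu [set: Omega] (fun w => rnorm (Lambda w f) ^+ 2)
  <= B * rnorm f ^+ 2.
Proof.
have [_ _ _ /(_ f)[fA fB]] := frameL.
have := integrable_fin_num measurableT (integrable_frame_norm f).
by move=> /fineK; rewrite -!lee_fin /Rintegral => ->; rewrite fA fB.
Qed.

Section bounded_symbol.
Variables (m : Omega -> R[i]) (C : R).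
Hypothesis mRe : measurable_fun [set: Omega] (fun w => complex.Re (m w)).
Hypothesis mIm : measurable_fun [set: Omega] (fun w => complex.Im (m w)).
Hypothesis mC : {ae mu, forall w, rnorm (m w) <= C}.

Let symbol_form f g w := m w * inner (Lambda w f) (Lambda w g).

Let sq_sum f g w := rnorm (Lambda w f) ^+ 2 + rnorm (Lambda w g) ^+ 2.

Let integrable_sq_sum f g :
  mu.-integrable [set: Omega] (fun w => (C * sq_sum f g w)%:E).
Proof.
by apply: integrable_realZ; apply: integrable_realD;
  exact: integrable_frame_norm.
Qed.

Let symbol_form_bound f g : {ae mu, forall w,
  `|complex.Re (symbol_form f g w)| <= C * sq_sum f g w /\
  `|complex.Im (symbol_form f g w)| <= C * sq_sum f g w}.
Proof.
apply: filterS mC => w mwC; rewrite /symbol_form /sq_sum.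
set x := Lambda w f; set y := Lambda w g.
have hr := le_trans (normr_Re_le (m w)) mwC.
have hi := le_trans (normr_Im_le (m w)) mwC.
have C0 : 0 <= C by apply: le_trans mwC; exact: rnorm_nneg.
have xy : rnorm x * rnorm y <= 2^-1 * (rnorm x ^+ 2 + rnorm y ^+ 2).
  by have := sqr_ge0 (rnorm x - rnorm y); rewrite sqrrB; lra.
have zr : `|complex.Re (inner x y)| <= 2^-1 * (rnorm x ^+ 2 + rnorm y ^+ 2).
  exact: le_trans (rdot_CS x y) xy.
have zi : `|complex.Im (inner x y)| <= 2^-1 * (rnorm x ^+ 2 + rnorm y ^+ 2).
  rewrite Im_inner; apply: le_trans (rdot_CS _ _) _.
  by rewrite rnormZ {2}/rnorm normc_def/= expr0n expr1n add0r sqrtr1 mul1r.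
(* each of the two products in Re (m z) and Im (m z) takes half of the bound *)
have e : C * (rnorm x ^+ 2 + rnorm y ^+ 2) =
  C * (2^-1 * (rnorm x ^+ 2 + rnorm y ^+ 2)) +
  C * (2^-1 * (rnorm x ^+ 2 + rnorm y ^+ 2)) by field.
split; rewrite ?ReM ?ImM e.
- by rewrite (le_trans (ler_normB _ _))// !normrM lerD// ler_pM.
- by rewrite (le_trans (ler_normD _ _))// !normrM lerD// ler_pM.
Qed.

Let cintegrable_symbol f g : cintegrable mu (symbol_form f g).
Proof.
split; apply: ae_le_integrable (integrable_sq_sum f g) _.
- rewrite /symbol_form; under eq_fun do rewrite ReM.
  apply: measurable_funB; apply: measurable_funM => //.
    exact: measurable_rdot_frame.
  exact: measurable_Im_frame.
- by apply: filterS (symbol_form_bound f g) => w [].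
- rewrite /symbol_form; under eq_fun do rewrite ImM.
  apply: measurable_funD; apply: measurable_funM => //.
    exact: measurable_Im_frame.
  exact: measurable_rdot_frame.
- by apply: filterS (symbol_form_bound f g) => w [].
Qed.

(** The form is bounded by |C| B (|f|^2 + |g|^2), hence is represented by an
    operator, so the multiplier is not the default value. *)
Lemma cg_multiplierE f g :
  inner (cg_multiplier mu m Lambda Lambda f) g =
  cintegral mu (fun w => m w * inner (Lambda w f) (Lambda w g)).
Proof.
pose q f g := cintegral mu (symbol_form f g).
have q_linearl a x y z : q (a *: x + y) z = a * q x z + q y z.
  rewrite /q -cintegral_linear//; congr cintegral; apply/funext => w.
  by rewrite /symbol_form bop_linear innerDl innerZl; ring.
have q_linearr a x y z : q z (a *: x + y) = a^*%C * q z x + q z y.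
  rewrite /q -cintegral_linear//; congr cintegral; apply/funext => w.
  by rewrite /symbol_form bop_linear innerDr innerZr; ring.
have q_bound x y : complex.Re (q x y) <= `|C| * B * (rnorm x ^+ 2 + rnorm y ^+ 2).
  have [reI _] := cintegrable_symbol x y.
  apply: (@le_trans _ _ (Rintegral mu setT (fun w => C * sq_sum x y w))).
    apply: ae_le_Rintegral; [exact: reI|exact: integrable_sq_sum|].
    apply: filterS (symbol_form_bound x y) => w [+ _].
    exact: le_trans (ler_norm _).
  rewrite /sq_sum RintegralZl// ?RintegralD//; first last.
  - by apply: integrable_realD; exact: integrable_frame_norm.
  - exact: integrable_frame_norm.
  - exact: integrable_frame_norm.
  have /andP[_ xB] := frame_bounds x; have /andP[_ yB] := frame_bounds y.
  rewrite -mulrA [in leRHS]mulrDr (le_trans (ler_norm _))// normrM ler_wpM2l// ger0_norm ?lerD//.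
  by rewrite addr_ge0// Rintegral_ge0// => w _; exact: sqr_ge0.
have := form_representation q_linearl q_linearr q_bound.
by move=> /(xgetPex (bop0 H H)) /(_ f g).
Qed.

(** On the diagonal <Lambda f, Lambda f> is real and nonnegative, so only Re m
    enters the real part of the form. *)
Lemma cg_multiplier_coercive (c : R) f : 0 <= c ->
    {ae mu, forall w, c <= complex.Re (m w)} ->
  c * A * rnorm f ^+ 2 <= rdot (cg_multiplier mu m Lambda Lambda f) f.
Proof.
move=> c0 mc; rewrite /rdot cg_multiplierE /cintegral/=.
have /andP[fA _] := frame_bounds f.
rewrite -mulrA (le_trans (ler_wpM2l c0 fA))// -RintegralZl//; last first.
  exact: integrable_frame_norm.
apply: ae_le_Rintegral.
- by apply: integrable_realZ; exact: integrable_frame_norm.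
- exact: (cintegrable_symbol f f).1.
- apply: filterS mc => w mwc.
  by rewrite innerxx ReM/= mulr0 subr0 ler_wpM2r// sqr_ge0.
Qed.

Lemma cg_multiplier_invertible (c : R) : 0 < c ->
    {ae mu, forall w, c <= complex.Re (m w)} ->
  bop_invertible (cg_multiplier mu m Lambda Lambda).
Proof.
move=> c0 mc; have [_ A0 _ _] := frameL.
apply: (@coercive_invertible _ _ _ (c * A)); first exact: mulr_gt0.
by move=> x; apply: cg_multiplier_coercive => //; exact: ltW.
Qed.

Lemma cg_multiplier_selfadjoint f g : (forall w, complex.Im (m w) = 0) ->
  inner (cg_multiplier mu m Lambda Lambda f) g =
  inner f (cg_multiplier mu m Lambda Lambda g).
Proof.
move=> m_real; rewrite [RHS]innerC !cg_multiplierE -cintegral_conj; last exact: cintegrable_symbol.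
congr cintegral; apply/funext => w; rewrite rmorphM/= -innerC.
by case: (m w) (m_real w) => a b /= ->; rewrite oppr0.
Qed.

End bounded_symbol.

Lemma cg_frame_operatorE :
  cg_frame_operator mu Lambda = cg_multiplier mu (fun=> 1) Lambda Lambda.
Proof.
rewrite /cg_frame_operator /cg_multiplier; congr xget.
by apply/seteqP; split => S SE f g; rewrite SE; congr cintegral;
  apply/funext => w; rewrite mul1r.
Qed.

Lemma cg_frame_operator_selfadjoint f g :
  inner (cg_frame_operator mu Lambda f) g = inner f (cg_frame_operator mu Lambda g).
Proof.
rewrite cg_frame_operatorE; apply: (@cg_multiplier_selfadjoint _ 1) => //=.
by apply: aeW => w; rewrite rnorm1.
Qed.

Lemma cg_frame_operator_invertible : bop_invertible (cg_frame_operator mu Lambda).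
Proof.
rewrite cg_frame_operatorE; apply: (@cg_multiplier_invertible _ 1 _ _ _ 1) => //=.
  by apply: aeW => w; rewrite rnorm1.
exact: aeW.
Qed.

(** An operator is determined by its form. *)
Lemma cg_multiplier_unique m (Theta1 Theta2 : forall w, bop H (K w)) (T : bop H H) :
    (forall f g, inner (T f) g =
      cintegral mu (fun w => m w * inner (Theta2 w f) (Theta1 w g))) ->
  cg_multiplier mu m Theta1 Theta2 = T.
Proof.
move=> TE; apply: xget_unique => // U UE.
by apply: eq_bop => x; apply: inner_inj => z; rewrite TE UE.
Qed.

End multipliers.

(** * Inverses of the multipliers with the canonical dual *)

Theorem corollary2p8 (R : realType) (d : measure_display)
    (Omega : measurableType d) (mu : {measure set Omega -> \bar R})
    (H : hilbertType R) (K : Omega -> hilbertType R)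
    (Lambda : forall w : Omega, bop H (K w)) (A B : R) (m : Omega -> R[i]) :
  cg_frame mu Lambda A B ->
  is_Linfty mu m ->
  (exists2 delta : R, 0 < delta & {ae mu, forall w, delta%:C <= m w}) \/
  (exists2 lambda : R,
     (Linfty_norm mu (fun w => (m w - 1)%R) <= lambda%:E)%E & lambda < A / B) ->
  let S := cg_frame_operator mu Lambda in
  let dual := canonical_dual mu Lambda in
  let M := cg_multiplier mu m Lambda Lambda in
  let M1 := cg_multiplier mu m Lambda dual in
  let M2 := cg_multiplier mu m dual Lambda in
  [/\ bop_invertible M1, bop_invertible M2, bop_invertible M,
      bop_inv M1 = bop_comp S (bop_inv M) &
      bop_inv M2 = bop_comp (bop_inv M) S].
Proof.
move=> frameL [mRe mIm mfin] mcond S dual M M1 M2.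
have [C mC] : exists C : R, {ae mu, forall w, rnorm (m w) <= C}.
  exists (fine (Linfty_norm mu m)); apply: Linfty_norm_ae.
  by rewrite fineK// ge0_fin_numE// /Linfty_norm Lnorm_ge0.
have [c c0 mc] : exists2 c : R, 0 < c & {ae mu, forall w, c <= complex.Re (m w)}.
  case: mcond => [[delta delta0 mdelta]|[lambda mlambda lambdaAB]].
    by exists delta => //; apply: filterS mdelta => w; rewrite lecE => /andP[].
  have [_ A0 AB _] := frameL.
  have lambda1 : lambda < 1.
    apply: lt_le_trans lambdaAB _.
    by rewrite ler_pdivrMr ?mul1r// (lt_le_trans A0).
  exists (1 - lambda); first by rewrite subr_gt0.
  apply: filterS (Linfty_norm_ae mlambda) => w mw.
  have := le_trans (normr_Re_le _) mw; rewrite ReD/= ler_norml.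
  by move=> /andP[+ _]; lra.
have ME := cg_multiplierE frameL mRe mIm mC.
have Minv : bop_invertible M := cg_multiplier_invertible frameL mRe mIm mC c0 mc.
have [KM MK] := bop_invP Minv.
have [KS SK] := bop_invP (cg_frame_operator_invertible frameL).
have M1E : M1 = bop_comp M (bop_inv S).
  by apply: cg_multiplier_unique => f g; rewrite ME.
have Sinv_sym f g : inner (bop_inv S f) g = inner f (bop_inv S g).
  by rewrite -{1}[g]SK -(cg_frame_operator_selfadjoint frameL) SK.
have M2E : M2 = bop_comp (bop_inv S) M.
  by apply: cg_multiplier_unique => f g; rewrite Sinv_sym ME.
have M1inv : is_bop_inverse M1 (bop_comp S (bop_inv M)).
  by rewrite M1E; split => x /=; rewrite ?KM ?SK ?KS ?MK.
have M2inv : is_bop_inverse M2 (bop_comp (bop_inv M) S).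
  by rewrite M2E; split => x /=; rewrite ?SK ?KM ?MK ?KS.
split; [by eexists; exact: M1inv|by eexists; exact: M2inv|exact: Minv| |].
- exact: bop_invE.
- exact: bop_invE.
Qed.
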